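(* Let $S$ be a real $d\times d'$ matrix, let $S_{\rm red}$ be a reduced $S$-matrix and $U_{\rm red}$ the corresponding reduced flux pattern. Suppose $S_{\rm red}$ is a generic square invertible matrix. Then: (1) The number of terms in the core determinant $\operatorname{cd}(S)$ equals the number of terms in the determinant expansion of $U_{\rm red}$. (2) The number of anomalous signs of the core determinant $\operatorname{cd}(S)$ is the number of anomalous signs in the determinant expansion of $U_{\rm red}$.
   Context: Flux pattern: for a real $d\times d'$ matrix $S$, $U$ is the $d'\times d$ matrix whose $(j,i)$ entry is a free variable $U_{ji}$ if $S_{ij}<0$ and $0$ if $S_{ij}\ge 0$. With $r=\operatorname{rank}(S)$, the core determinant is $\operatorname{cd}(S)=\lim_{t\to 0}\frac{1}{t^{d-r}}\det(SU-tI)$, a polynomial in the variables $U_{ji}$. A column $c$ of $S$ is reversible if $-c$ is also a column of $S$; $-c$ is the reverse of $c$. A reduced $S$-matrix $S_{\rm red}$ is a matrix obtained from $S$ by removing one column out of every pair of columns which are reverses of each other; $S_{\rm red}$ contains no reversible columns. The reduced flux pattern $U_{\rm red}$ is built from the sign pattern of $-S_{\rm red}^T$ by setting to $0$ all entries coming from positive entries in columns nonreversible in $S$. In particular, if all columns of $S$ are reversible, $U_{\rm red}$ is the sign pattern of $-S_{\rm red}^T$; if no column of $S$ is reversible, $S_{\rm red}=S$ and $U_{\rm red}=U$. A sign pattern is a matrix whose entries are $\pm$ free variables (one per position) or $0$; the sign pattern of a real matrix $B$ has a free variable with sign $+$, a free variable with sign $-$, or $0$ where $B$ is positive, negative, zero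 respectively. The determinant expansion of a square sign pattern is its determinant as a polynomial in the free variables. For a polynomial in free variables (such as $\operatorname{cd}(S)$ or a determinant expansion), the number of anomalous signs is the minimum of the number of terms with positive sign and the number of terms with negative sign. A real matrix is weakly generic if its rank $r$ is maximal among all matrices with the same sign pattern; it is generic if in addition all its $r\times r$ submatrices are weakly generic. *)

(* Defs.v *)
From HB Require Import structures.
From mathcomp Require Import all_boot all_order all_algebra.
From mathcomp Require Import -(notations) mpoly.
From mathcomp Require Import all_classical all_reals topology normedtype.
Set Implicit Arguments.
Unset Strict Implicit.
Unset Printing Implicit Defensive.
Import Order.TTheory GRing.Theory Num.Theory numFieldNormedType.Exports.
Local Open Scope classical_set_scope.
Local Open Scope ring_scope.

(* The notations of mpoly.v clash with those of MathComp-Analysis and are not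
   imported: mpoly n R is {mpoly R[n]}, mcoeff m p is p@_m, mpolyX R m is the
   monomial m as a polynomial, mnm1 i is the monomial of the i-th variable, and
   bmultinom n k is 'X_{1..n < k}. *)

Section Patterns.
Variable R : realType.

(* One free variable per matrix position; the variables of an m x n pattern are
   numbered by mxvec_index. *)
Definition free_var m n (i : 'I_m) (j : 'I_n) : mpoly (m * n) R :=
  mpolyX R (mnm1 (mxvec_index i j)).

Definition sign_pattern m n (B : 'M[R]_(m, n)) :
    'M[mpoly (m * n) R]_(m, n) :=
  \matrix_(i, j) if 0 < B i j then free_var i j
                 else if B i j < 0 then - free_var i j else 0.

Definition weakly_generic m n (A : 'M[R]_(m, n)) : Prop :=
  forall B : 'M[R]_(m, n),
    sign_pattern B = sign_pattern A -> (\rank B <= \rank A)%N.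

Definition increasing m n (f : 'I_m -> 'I_n) : Prop :=
  forall i j : 'I_m, (i < j)%N -> (f i < f j)%N.

Definition generic m n (A : 'M[R]_(m, n)) : Prop :=
  weakly_generic A /\
  forall (f : 'I_(\rank A) -> 'I_m) (g : 'I_(\rank A) -> 'I_n),
    increasing f -> increasing g -> weakly_generic (mxsub f g A).

Definition flux_pattern d d' (S : 'M[R]_(d, d')) :
    'M[mpoly (d' * d) R]_(d', d) :=
  \matrix_(j, i) if S i j < 0 then free_var j i else 0.

(* det (S U - t I), for a real number t *)
Definition char_det d d' (S : 'M[R]_(d, d')) (t : R) :
    mpoly (d' * d) R :=
  \det (map_mx (@mpolyC (d' * d) R) S *m flux_pattern S
        - (mpolyC (d' * d) t)%:M).

(* The limit is taken coefficient by coefficient. Only monomials of degree at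
   most d occur in det (S U - t I), so the sum below omits no term. *)
Definition core_det d d' (S : 'M[R]_(d, d')) : mpoly (d' * d) R :=
  \sum_(m : bmultinom (d' * d) d.+1)
    lim ((t ^- (d - \rank S) * mcoeff m (char_det S t)) @[t --> 0^'])
      *: mpolyX R m.

Definition reversible d d' (S : 'M[R]_(d, d')) (c : 'cV[R]_d) : bool :=
  [exists k, col k S == - c].

(* Sred keeps the columns of S indexed by the range of f. Every removed column
   k is paired with a column rho k equal to its reverse, and distinct removed
   columns belong to distinct pairs (this matters when S has repeated columns).
   One column of each pair is kept; the exception rho k = k can only occur for
   a zero column, which is its own reverse. *)
Definition reduced_matrix d d' n (S : 'M[R]_(d, d')) (Sred : 'M[R]_(d, n)) :
    Prop :=
  exists (f : 'I_n -> 'I_d') (rho : 'I_d' -> 'I_d'),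
    [/\ increasing f,
        Sred = colsub f S,
        forall k, k \notin codom f ->
          col (rho k) S = - col k S /\ (rho k \in codom f \/ rho k = k),
        forall k l, k \notin codom f -> l \notin codom f ->
          rho k = rho l -> k = l
      & forall j, ~~ reversible Sred (col j Sred)].

(* Whether a column of Sred is reversible is decided in S, not in Sred. *)
Definition reduced_flux_pattern d d' n (S : 'M[R]_(d, d'))
    (Sred : 'M[R]_(d, n)) : 'M[mpoly (n * d) R]_(n, d) :=
  \matrix_(j, i) if (0 < Sred i j) && ~~ reversible S (col j Sred) then 0
                 else sign_pattern (- Sred^T) j i.

Definition num_terms n (p : mpoly n R) : nat := size (msupp p).

Definition num_anomalous_signs n (p : mpoly n R) : nat :=
  minn (count (fun m => 0 < mcoeff m p) (msupp p))
       (count (fun m => mcoeff m p < 0) (msupp p)).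

End Patterns.

(* Main.v *)
(* Since Sred is invertible, S has rank d, and therefore cd(S) = det(S U). Put
   W = Sred^-1 S: a column of S equal to plus or minus the q-th column of Sred
   gives plus or minus the q-th unit vector as a column of W. In the (q, i)
   entry of W U at most one variable survives, with the sign of the (q, i)
   entry of Ured; if Sred i q < 0 it comes from the copy of column q kept in
   Sred, and if Sred i q > 0 from the removed reverse. Thus W U is Ured after an
   injective renaming of the variables, and cd(S) = det(Sred) det(W U) has the
   terms of det(Ured), all multiplied by the nonzero number det(Sred). *)

Require Import Defs.
From mathcomp Require Import all_boot all_order all_algebra.
From mathcomp Require Import -(notations) mpoly.
From mathcomp Require Import all_classical all_reals.
From mathcomp Require Import perm topology normedtype derive.
Import Order.TTheory GRing.Theory Num.Theory numFieldNormedType.Exports.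
Local Open Scope ring_scope.

(** * Term and sign counts under scaling *)

Lemma num_terms_scale (R : realType) n (c : R) (p : mpoly n R) :
  c != 0 -> num_terms (c *: p) = num_terms p.
Proof. by move=> c0; apply/perm_size/msuppZ. Qed.

(** A negative factor swaps positive and negative terms, which the minimum does not see. *)
Lemma num_anomalous_signs_scale (R : realType) n (c : R) (p : mpoly n R) :
  c != 0 -> num_anomalous_signs (c *: p) = num_anomalous_signs p.
Proof.
move=> c0; rewrite /num_anomalous_signs !(seq.permP (msuppZ _ _)) //.
have := c0; rewrite neq_lt => /orP[cN|cP].
  rewrite minnC; congr minn; apply: eq_count => m /=;
  by rewrite mcoeffZ ?nmulr_rgt0 ?nmulr_rlt0.
by congr minn; apply: eq_count => m /=; rewrite mcoeffZ ?pmulr_rgt0 ?pmulr_rlt0.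
Qed.

(** * Injective renaming of variables *)

Section Renaming.
Variables (R : realType) (m n : nat) (v : 'I_m -> 'I_n).
Hypothesis v_inj : injective v.

Definition rename (p : mpoly m R) : mpoly n R :=
  comp_mpoly [tuple mpolyX R (mnm1 (v i)) | i < m] p.

Definition rename_monomial (u : multinom m) : multinom n :=
  \big[@mnm_add n/@mnm0 n]_(i < m) mnm_muln (mnm1 (v i)) (u i).

Lemma renameE p :
  rename p = \sum_(u <- msupp p) mcoeff u p *: mpolyX R (rename_monomial u).
Proof.
rewrite /rename comp_mpolyE; apply: eq_bigr => u _; congr (_ *: _).
by rewrite -mprodXnE; apply: eq_bigr => i _; rewrite tnth_mktuple.
Qed.

Lemma renameX i : rename (mpolyX R (mnm1 i)) = mpolyX R (mnm1 (v i)).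
Proof. by rewrite /rename comp_mpolyXU -tnth_nth tnth_mktuple. Qed.

Lemma rename0 : rename 0 = 0.
Proof. exact: comp_mpoly0. Qed.

Lemma renameN p : rename (- p) = - rename p.
Proof. exact: comp_mpolyN. Qed.

Lemma det_rename k (A : 'M[mpoly m R]_k) :
  \det (map_mx rename A) = rename (\det A).
Proof. exact: det_map_mx. Qed.

(** As [v] is injective, the exponent of variable [v i] in the image is exactly [u i], so [u] can be
    read off. *)
Lemma rename_monomial_inj : injective rename_monomial.
Proof.
have vE u i : rename_monomial u (v i) = u i.
  rewrite mnm_sumE (bigD1 i) //= mulmnE mnm1E eqxx mul1n big1 ?addn0 // => j ji.
  by rewrite mulmnE mnm1E (inj_eq v_inj) (negPf ji).
by move=> u w uw; apply/mnmP => i; rewrite -!vE uw.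
Qed.

Lemma mcoeff_rename p u : mcoeff (rename_monomial u) (rename p) = mcoeff u p.
Proof.
rewrite renameE raddf_sum /= [in RHS](mpolyE p) raddf_sum /=.
by apply: eq_bigr => w _; rewrite !mcoeffZ !mcoeffX (inj_eq rename_monomial_inj).
Qed.

Lemma msupp_rename p : perm_eq (msupp (rename p)) (map rename_monomial (msupp p)).
Proof.
have -> : rename p = \sum_(w <- map rename_monomial (msupp p))
    mcoeff w (rename p) *: mpolyX R w.
  by rewrite big_map renameE; apply: eq_bigr => u _;
     rewrite -renameE mcoeff_rename.
apply: msupp_sumX.
  by rewrite map_inj_uniq ?msupp_uniq //; apply: rename_monomial_inj.
by move=> _ /mapP[u up ->]; rewrite mcoeff_rename -mcoeff_msupp.
Qed.

Lemma num_terms_rename p : num_terms (rename p) = num_terms p.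
Proof. by rewrite /num_terms (perm_size (msupp_rename p)) size_map. Qed.

Lemma num_anomalous_signs_rename p :
  num_anomalous_signs (rename p) = num_anomalous_signs p.
Proof.
rewrite /num_anomalous_signs !(seq.permP (msupp_rename p)) !count_map.
by congr minn; apply: eq_count => u /=; rewrite mcoeff_rename.
Qed.

End Renaming.

Arguments rename {R m n}.

(** * The core determinant at full rank *)

Section CoreDeterminant.
Variables (R : realType) (d d' : nat) (S : 'M[R]_(d, d')).

Definition flux_mx := map_mx (@mpolyC (d' * d) R) S *m flux_pattern S.

(** The entries of [flux_mx] are linear forms. The resulting degree bound shows that the sum in
    [core_det] reaches every monomial of this determinant. *)
Lemma det_flux_mx_homog :
  \det flux_mx \is ishomog1 d (Measure.clone _ (@mdeg (d' * d)) _).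
Proof.
rewrite /determinant rpred_sum // => s _; rewrite rpredMsign.
have homD : \prod_(i < d) flux_mx i (s i) \is ishomog1 (\sum_(i < d) 1)
    (Measure.clone _ (@mdeg (d' * d)) _).
  elim/big_ind2: _ => [|k p l q|i _]; [exact: dhomog1|exact: dhomogM|].
  rewrite mxE rpred_sum // => k _; rewrite !mxE mul_mpolyC; apply: dhomogZ.
  by case: ifP => _; rewrite ?rpred0 // dhomogX; apply/eqP; exact: mdeg1.
by rewrite sum1_card card_ord in homD.
Qed.

(** Polynomial dependence on [t] supplies the continuity needed for the limit at 0. *)
Lemma mcoeff_char_det m :
  exists q : {poly R}, (forall t, mcoeff m (char_det S t) = q.[t]).
Proof.
(* [P] has an indeterminate in place of [t]; applying [mcoeff m] to its coefficients gives [q]. *)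
pose P := \det (map_mx polyC flux_mx - 'X%:M).
have PE t : char_det S t = P.[mpolyC _ t].
  rewrite -[RHS]/(horner_eval (mpolyC _ t) P) -det_map_mx; congr (\det _).
  apply/matrixP => i j; rewrite !mxE /= /horner_eval hornerD hornerN hornerC.
  by rewrite hornerMn hornerX.
exists (map_poly (mcoeff m) P) => t.
rewrite PE horner_coef raddf_sum /= (@horner_coef_wide _ (size P)) ?size_poly //.
apply: eq_bigr => i _.
by rewrite -rmorphXn /= mulrC mcoeffCM coef_map_id0 ?raddf0 // mulrC.
Qed.

(** The exponent [d - \rank S] vanishes, so each limit is the value at 0 of a polynomial in [t]. *)
Lemma core_det_full_rank : \rank S = d -> core_det S = \det flux_mx.
Proof.
move=> rS; rewrite [RHS](@mpolywE _ _ d.+1 _).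
  apply: eq_bigr => m _; congr (_ *: _).
  have [q qE] := mcoeff_char_det m.
  rewrite rS subnn; under eq_fun do rewrite expr0 invr1 mul1r qE.
  have -> : mcoeff m (\det flux_mx) = q.[0].
    by rewrite -qE /char_det mpolyC0 raddf0 subr0.
  apply: cvg_lim => //.
  by apply: cvg_trans (@continuous_horner _ q 0); apply: cvg_app;
     apply: cvg_within.
rewrite msizeE; apply/bigmax_leqP_seq => m mU _.
by rewrite ltnS (dhomog_mf det_flux_mx_homog mU).
Qed.

End CoreDeterminant.

Lemma mxvec_index_inj m n (i i' : 'I_m) (j j' : 'I_n) :
  mxvec_index i j = mxvec_index i' j' -> i = i' /\ j = j'.
Proof. by move/cast_ord_inj/enum_rank_inj => [-> ->]. Qed.

(** * Columns of [S] in the basis of columns of [Sred] *)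

Section Reduction.
Variables (R : realType) (d d' : nat) (S : 'M[R]_(d, d')) (Sred : 'M[R]_d).
Hypotheses (hred : reduced_matrix S Sred) (hinv : Sred \in unitmx).

Lemma invmx_col q : invmx Sred *m col q Sred = delta_mx q 0.
Proof. by rewrite colE mulmxA mulVmx // mul1mx. Qed.

Lemma col_Sred_inj q q' : col q Sred = col q' Sred -> q = q'.
Proof.
move/(congr1 (mulmx (invmx Sred))); rewrite !invmx_col => /matrixP/(_ q 0).
rewrite !mxE !eqxx andbT; case: eqVneq => // _ /eqP.
by rewrite oner_eq0.
Qed.

(** Taking [q = q'] also rules out a zero column in [Sred]. *)
Lemma col_Sred_neqN q q' : col q Sred = - col q' Sred -> False.
Proof.
case: hred => f [rho [_ _ _ _ /(_ q')]] /negP hr e.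
by apply: hr; apply/existsP; exists q; rewrite e.
Qed.

Lemma col_eqN_0 (c : 'cV[R]_d) : c = - c -> c = 0.
Proof.
move=> h; apply/matrixP => i j; apply/eqP.
move/matrixP/(_ i j): h; rewrite !mxE => /eqP.
by rewrite -addr_eq0 -mulr2n mulrn_eq0.
Qed.

(** A removed copy of column [q] would have as partner either a kept reverse of that column or
    itself, and then be zero; both are excluded. Reverses of column [q] are unique because [rho]
    sends each to [f q] and is injective on removed columns. *)
Lemma reduced_columns : exists f : 'I_d -> 'I_d',
  [/\ forall q, col (f q) S = col q Sred,
      forall k q, col k S = col q Sred -> k = f q,
      forall k l q, col k S = - col q Sred -> col l S = - col q Sred -> k = l
    & forall k, col k S = 0 \/
        exists q, col k S = col q Sred \/ col k S = - col q Sred].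
Proof.
have Ninj := col_Sred_neqN; have Sinj := col_Sred_inj.
case: hred => f [rho [_ SE rhoP rho_inj _]]; exists f.
have colf q : col (f q) S = col q Sred.
  by rewrite SE; apply/matrixP => i j; rewrite !mxE.
have removed k q : col k S = - col q Sred -> k \notin codom f /\ rho k = f q.
  move=> kq; have kf : k \notin codom f.
    by apply/negP => /codomP[q' kE]; move: kq; rewrite kE colf => /Ninj.
  split=> //; have [rk] := rhoP k kf; rewrite kq opprK in rk.
  case=> [/codomP[q' rkE]|rkk].
    by move: rk; rewrite rkE colf => /Sinj ->.
  by exfalso; apply: (Ninj q q); rewrite -kq -rk rkk.
split=> //.
- move=> k q kq; have [/codomP[q' kE]|kf] := boolP (k \in codom f).
    by move: kq; rewrite kE colf => /Sinj ->.
  have [rk] := rhoP k kf; case=> [/codomP[q' rkE]|rkk].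
    by exfalso; apply: (Ninj q' q); rewrite -colf -rkE rk kq.
  have /col_eqN_0 k0 : col k S = - col k S by rewrite -[in LHS]rkk.
  by exfalso; apply: (Ninj q q); rewrite -kq k0 oppr0.
- move=> k l q /removed[kf rk] /removed[lf rl]; apply: rho_inj => //.
  by rewrite rk rl.
- move=> k; have [/codomP[q ->]|kf] := boolP (k \in codom f).
    by right; exists q; left.
  have [rk] := rhoP k kf; case=> [/codomP[q rkE]|rkk].
    by right; exists q; right; rewrite -colf -rkE rk opprK.
  by left; apply: col_eqN_0; rewrite -[in LHS]rkk.
Qed.

Lemma rank_of_reduced : \rank S = d.
Proof.
apply/eqP; rewrite eqn_leq rank_leq_row /=.
case: hred => f [_ [_ SE _ _ _]].
have {1}<- : \rank Sred = d by apply: mxrank_unit.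
have -> : Sred = S *m colsub f 1%:M by rewrite mulmx_colsub mulmx1.
exact: mxrankM_maxl.
Qed.

Definition coord_mx : 'M[R]_(d, d') := invmx Sred *m S.

(** Multiplication by [invmx Sred] turns the columns of [Sred] into unit vectors. Zero columns of
    [S], which match no column of [Sred], fall under the first case. *)
Lemma coord_mx_spec q k :
  [\/ [/\ col k S <> col q Sred, col k S <> - col q Sred &
          coord_mx q k = 0 \/ col k S = 0],
      coord_mx q k = 1 /\ col k S = col q Sred
    | coord_mx q k = -1 /\ col k S = - col q Sred].
Proof.
have Ninj := col_Sred_neqN; have Sinj := col_Sred_inj.
have WE : coord_mx q k = (invmx Sred *m col k S) q 0.
  by rewrite colE mulmxA -colE [RHS]mxE.
have [f [_ _ _ /(_ k)]] := reduced_columns.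
case=> [k0|[q' [kq|kq]]].
- constructor 1; split; rewrite ?k0; last by right.
    by move=> q0; apply: (Ninj q q); rewrite -q0 oppr0.
  by move=> q0; apply: (Ninj q q); rewrite -q0 -[LHS]opprK -q0 oppr0.
- have := WE; rewrite kq invmx_col [RHS]mxE eqxx andbT.
  have [-> e|/eqP qq e] := eqVneq q q'; first by constructor 2.
  by constructor 1; split; [move/Sinj/esym|move/Ninj|left].
- have := WE; rewrite kq mulmxN invmx_col [RHS]mxE [delta_mx _ _ _ _]mxE.
  rewrite eqxx andbT.
  have [-> e|/eqP qq e] := eqVneq q q'; first by constructor 3.
  constructor 1; split; [by move/esym/Ninj|by move/oppr_inj/Sinj/esym|left].
  by rewrite e oppr0.
Qed.

Lemma coord_mx_flux : exists2 v : 'I_(d * d) -> 'I_(d' * d), injective v &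
  map_mx (@mpolyC (d' * d) R) coord_mx *m flux_pattern S =
  map_mx (rename v) (reduced_flux_pattern S Sred).
Proof.
have Ninj := col_Sred_neqN; have Sinj := col_Sred_inj.
have [f [colf f_uniq rev_uniq _]] := reduced_columns.
(* The fallback value f q of h, used when no column of S is the reverse of
   column q, belongs to a variable absent from W U; it only keeps v injective. *)
pose h q i := if 0 < Sred i q then odflt (f q) [pick k | col k S == - col q Sred]
              else f q.
have colh q i : col (h q i) S = col q Sred \/ col (h q i) S = - col q Sred.
  rewrite /h; case: ifP => _; last by left.
  by case: pickP => [k /eqP kq|_] /=; [right | left]; rewrite ?kq ?colf.
pose v x := mxvec (\matrix_(q < d, i < d) mxvec_index (h q i) i) 0 x.
have vE q i : v (mxvec_index q i) = mxvec_index (h q i) i.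
  by rewrite /v mxvecE mxE.
exists v.
  (* Equal images force equal [i] and columns [q], [q'] of [Sred] that agree up to sign; hence
     [q = q']. *)
  move=> x y; case/mxvec_indexP: x => q i; case/mxvec_indexP: y => q' i'.
  rewrite !vE => /mxvec_index_inj[hh ii]; rewrite -ii in hh *; congr mxvec_index.
  have [] := colh q i; rewrite hh; have [] := colh q' i => -> e.
  - exact/esym/Sinj.
  - by have := Ninj _ _ (esym e).
  - by have := Ninj _ _ e.
  - by move/oppr_inj: e => /Sinj.
apply/matrixP => q i; rewrite [LHS]mxE [RHS]mxE.
have renameF : rename v (free_var R q i) = free_var R (h q i) i.
  by rewrite /free_var renameX vE.
(* Only the summand [k = h q i] can be nonzero. *)
have term k : map_mx (@mpolyC (d' * d) R) coord_mx q k * flux_pattern S k i =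
    if k == h q i then rename v (reduced_flux_pattern S Sred q i) else 0.
  rewrite [map_mx _ _ _ _]mxE.
  have [[kp kn W0]|[-> kq]|[-> kq]] := coord_mx_spec q k.
  - case: eqVneq => [kh|_]; first by have [] := colh q i; rewrite -kh.
    case: W0 => [->|/matrixP/(_ i 0)]; first by rewrite mpolyC0 mul0r.
    by rewrite !mxE => ->; rewrite ltxx mulr0.
  - rewrite !mxE; have -> : S i k = Sred i q.
      by move/matrixP/(_ i 0): kq; rewrite !mxE.
    rewrite mpolyC1 mul1r oppr_gt0 oppr_lt0.
    have [a0|a0|a0] := ltgtP (Sred i q) 0 => /=.
    + by rewrite renameF /h ltNge (ltW a0) /= (f_uniq _ _ kq) eqxx.
    (* Here [S i k > 0] kills the flux entry. If [k = h q i], the fallback was used, so column [q]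
       has no reverse in [S] and its reduced flux entry is 0. *)
    + case: eqVneq => // kh; rewrite ifT ?rename0 //.
      apply/negP => /existsP[l lq]; move: kh; rewrite /h a0.
      case: pickP => [l' /eqP lq' /= kl|/(_ l)]; last by rewrite lq.
      by rewrite -kl kq in lq'; apply: Ninj lq'.
    + by rewrite rename0 if_same.
  - rewrite !mxE; have -> : S i k = - Sred i q.
      by move/matrixP/(_ i 0): kq; rewrite !mxE.
    rewrite mpolyCN mpolyC1 mulN1r !oppr_gt0 !oppr_lt0.
    have [a0|a0|a0] := ltgtP (Sred i q) 0 => /=.
    + rewrite oppr0 /h ltNge (ltW a0) /=; case: eqVneq => // kf.
      by move: kq; rewrite kf colf => /Ninj.
    (* The unique reverse [k] is the one picked by [h]; the coefficient -1 gives the sign in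
       [- Sred^T]. *)
    + have hk : h q i = k.
        rewrite /h a0; case: pickP => [l /eqP lq|/(_ k)]; last by rewrite kq eqxx.
        exact: rev_uniq lq kq.
      have -> : reversible S (col q Sred) by apply/existsP; exists k; apply/eqP.
      by rewrite hk eqxx renameN renameF hk.
    + by rewrite rename0 if_same oppr0.
by rewrite (eq_bigr _ (fun k _ => term k)) -big_mkcond big_pred1_eq.
Qed.

End Reduction.

Theorem theorem3p15 (R : realType) (d d' : nat) (S : 'M[R]_(d, d'))
    (Sred : 'M[R]_d) (hred : reduced_matrix S Sred)
    (hgen : generic Sred) (hinv : Sred \in unitmx) :
  num_terms (core_det S) = num_terms (\det (reduced_flux_pattern S Sred)) /\
  num_anomalous_signs (core_det S) =
    num_anomalous_signs (\det (reduced_flux_pattern S Sred)).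
Proof.
have [v v_inj WU] := coord_mx_flux _ _ _ _ _ hred hinv.
have -> : core_det S = \det Sred *: rename v (\det (reduced_flux_pattern S Sred)).
  rewrite core_det_full_rank ?(rank_of_reduced _ _ _ _ _ hred hinv) //.
  (* Both factors merge into one determinant, where [Sred *m coord_mx] collapses to [S]. *)
  rewrite -det_rename -WU -mul_mpolyC -det_map_mx -det_mulmx mulmxA -map_mxM /coord_mx.
  by rewrite mulKVmx.
have det0 : \det Sred != 0 by rewrite -unitfE -unitmxE.
by rewrite num_terms_scale // num_anomalous_signs_scale // num_terms_rename
   // num_anomalous_signs_rename.
Qed.
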